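(* Let $X$ be a non-reflexive $L$-embedded Banach space and let $Y$ be a Banach space. If either $X^{**}$ or $Y$ has the metric approximation property, then the projective tensor product $X\widehat{\otimes}_\pi Y$ has an octahedral norm.
   Context: All Banach spaces are real and non-zero. $X\widehat{\otimes}_\pi Y$ denotes the (completed) projective tensor product. A Banach space $X$ is $L$-embedded if there is a subspace $Z\subseteq X^{**}$ such that $X^{**}=X\oplus_1 Z$ (with $X$ canonically embedded in $X^{**}$ and $\oplus_1$ the $\ell_1$-sum, i.e. $\|x+z\|=\|x\|+\|z\|$). A Banach space $W$ has the metric approximation property (MAP) if there is a net $(S_\alpha)$ of finite-rank bounded operators on $W$ with $\|S_\alpha\|\leq 1$ and $S_\alpha w\to w$ for all $w\in W$. The norm of a Banach space $W$ is octahedral if for every finite-dimensional subspace $E$ of $W$ and every $\varepsilon>0$ there exists $y\in S_W$ (the unit sphere) such that $\|x+\lambda y\|\geq(1-\varepsilon)(\|x\|+|\lambda|)$ for every $x\in E$ and every $\lambda\in\mathbb{R}$. *)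

(* Defs.v *)
From HB Require Import structures.
From mathcomp Require Import all_boot all_order all_algebra sesquilinear.
From mathcomp Require Import mathcomp_extra boolp classical_sets functions.
From mathcomp Require Import reals topology normedtype lra.

Set Implicit Arguments.
Unset Strict Implicit.
Unset Printing Implicit Defensive.

Import Order.TTheory GRing.Theory Num.Theory.
Import numFieldNormedType.Exports.

Local Open Scope classical_set_scope.
Local Open Scope ring_scope.

Definition bounded_linear {R : realType} {V W : normedModType R}
    : {pred V -> W} :=
  fun f => `[< linear f /\ exists M : R, forall x, `|f x| <= M * `|x| >].

Section bounded_operators.
Variables (R : realType) (V W : normedModType R).

Record bop := Bop {
  bop_fun :> V -> W ;
  bop_funP : bop_fun \in @bounded_linear R V W }.

HB.instance Definition _ := [isSub of bop for bop_fun].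
HB.instance Definition _ := [Choice of bop by <:].

Lemma bounded_linear_submod_closed : submod_closed (@bounded_linear R V W).
Proof.
split.
  apply/asboolP; split=> [a x y|]; first by rewrite scaler0 addr0.
  by exists 0 => x; rewrite normr0 mul0r.
move=> a f g /asboolP[lf [M fM]] /asboolP[lg [N gN]]; apply/asboolP.
rewrite addrfctE scalrfctE.
split=> [b x y|]; rewrite /=.
  rewrite lf lg scalerDr scalerA mulrC -scalerA scalerDr -!addrA; congr (_ + _).
  by rewrite addrCA.
exists (`|a| * M + N) => x; rewrite mulrDl (le_trans (ler_normD _ _))//.
by rewrite lerD// normrZ -mulrA ler_wpM2l.
Qed.

HB.instance Definition _ := GRing.isSubmodClosed.Build _ _
  (@bounded_linear R V W) bounded_linear_submod_closed.
HB.instance Definition _ := [SubChoice_isSubLmodule of bop by <:].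

Lemma bop_linear (f : bop) : linear f.
Proof. by case: f => f /= /asboolP[]. Qed.

HB.instance Definition _ (f : bop) :=
  GRing.isLinear.Build R V W *:%R f (bop_linear f).

Lemma bop_bounded (f : bop) : exists M : R, forall x, `|f x| <= M * `|x|.
Proof. by case: f => f /= /asboolP[]. Qed.

Lemma bopD (f g : bop) x : (f + g) x = f x + g x. Proof. by []. Qed.
Lemma bopB (f g : bop) x : (f - g) x = f x - g x. Proof. by []. Qed.
Lemma bopZ (a : R) (f : bop) x : (a *: f) x = a *: f x. Proof. by []. Qed.
Lemma bop0 x : (0 : bop) x = 0. Proof. by []. Qed.

Lemma bopP (f g : bop) : f =1 g -> f = g.
Proof. by move=> fg; apply/val_inj/funext. Qed.

Definition opnorm (f : bop) : R := sup [set `|f x| | x in [set x | `|x| <= 1]].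

Let opnorm_has_ub (f : bop) : has_ubound [set `|f x| | x in [set x | `|x| <= 1]].
Proof.
have [M fM] := bop_bounded f; exists `|M| => _ [x /= x1 <-].
rewrite (le_trans (fM _))// (le_trans (ler_norm _))// normrM normr_id.
by rewrite ler_piMr.
Qed.

Lemma opnorm_ge0 (f : bop) : 0 <= opnorm f.
Proof.
by apply: ub_le_sup => //; exists 0; rewrite /= ?linear0 ?normr0.
Qed.

Lemma ler_opnorm (f : bop) x : `|f x| <= opnorm f * `|x|.
Proof.
have [->|x0] := eqVneq x 0; first by rewrite linear0 !normr0 mulr0.
have nx0 : 0 < `|x| by rewrite normr_gt0.
rewrite -ler_pdivrMr//; apply: ub_le_sup => //.
exists (`|x|^-1 *: x) => /=; first by rewrite normfZV.
by rewrite linearZ normrZ gtr0_norm ?invr_gt0// mulrC.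
Qed.

Lemma opnorm_le (f : bop) M : 0 <= M ->
  (forall x, `|f x| <= M * `|x|) -> opnorm f <= M.
Proof.
move=> M0 fM; apply: ge_sup.
  by exists `|f 0|; exists 0 => //=; rewrite normr0.
by move=> _ [x /= x1 <-]; rewrite (le_trans (fM _))// ler_piMr.
Qed.

Let opnormD f g : opnorm (f + g) <= opnorm f + opnorm g.
Proof.
apply: opnorm_le => [|x]; first by rewrite addr_ge0// opnorm_ge0.
by rewrite mulrDl (le_trans (ler_normD _ _))// lerD// ler_opnorm.
Qed.

Let opnormZ_le (a : R) f : opnorm (a *: f) <= `|a| * opnorm f.
Proof.
apply: opnorm_le => [|x]; first by rewrite mulr_ge0// opnorm_ge0.
by rewrite normrZ -mulrA ler_wpM2l// ler_opnorm.
Qed.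

Let opnormZ (a : R) f : opnorm (a *: f) = `|a| * opnorm f.
Proof.
apply/eqP; rewrite eq_le opnormZ_le/=.
have [->|a0] := eqVneq a 0; first by rewrite normr0 mul0r opnorm_ge0.
rewrite -ler_pdivlMl ?normr_gt0// -normfV.
by rewrite (le_trans _ (opnormZ_le _ _))// scalerA mulVf// scale1r.
Qed.

Let opnorm_eq0 f : opnorm f = 0 -> f = 0.
Proof.
move=> f0; apply: bopP => x; apply/eqP; rewrite -normr_le0.
by rewrite (le_trans (ler_opnorm _ _))// f0 mul0r.
Qed.

HB.instance Definition _ :=
  Lmodule_isNormed.Build R bop opnormD opnormZ opnorm_eq0.

Lemma bop_normE (f : bop) : `|f| = opnorm f. Proof. by []. Qed.

Lemma ler_norm_bop (f : bop) x : `|f x| <= `|f| * `|x|.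
Proof. exact: ler_opnorm. Qed.

Lemma bop_norm_le (f : bop) M : 0 <= M ->
  (forall x, `|f x| <= M * `|x|) -> `|f| <= M.
Proof. exact: opnorm_le. Qed.

End bounded_operators.

Section bounded_operators_complete.
Variables (R : realType) (V : normedModType R) (W : completeNormedModType R).

Lemma bop_complete (F : set_system (bop V W)) :
  ProperFilter F -> cauchy F -> cvg F.
Proof.
move=> FF /cauchyP Fc.
pose Fx x : set_system W := (fun g : bop V W => g x) @ F.
have Fxcvg x : cvg (Fx x).
  apply: cauchy_cvg; apply/cauchy_exP => e e0.
  have d0 : 0 < e / (`|x| + 1) by rewrite divr_gt0// ltr_wpDl.
  have [g Fg] := Fc _ d0; exists (g x).
  change (F [set h : bop V W | ball (g x) e (h x)]); apply: filterS Fg => h; rewrite -!ball_normE/= => gh.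
  rewrite (_ : g x - h x = (g - h) x)// (le_lt_trans (ler_norm_bop _ _))//.
  have : `|g - h| * `|x| <= `|g - h| * (`|x| + 1) by rewrite ler_wpM2l// lerDl.
  move/le_lt_trans; apply.
  by rewrite -ltr_pdivlMr// ltr_wpDl.
pose f x : W := lim (Fx x).
have fE x : (fun g : bop V W => g x) @ F --> f x by exact: Fxcvg.
have lf : linear f.
  move=> a x y; apply: cvg_lim => //.
  rewrite (_ : (fun g : bop V W => g (a *: x + y)) @ F = (fun g : bop V W => a *: g x + g y) @ F); last first.
    by congr (_ @ F); apply/funext => g; rewrite linearP.
  by apply: cvgD => //; apply: cvgZl_tmp.
have fle g e : 0 < e -> F (ball g e) -> forall x, `|g x - f x| <= e * `|x|.
  move=> e0 Fg x; apply/ler_addgt0Pr => d d0.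
  have /cvgrPdist_le/(_ d d0) fd := fE x.
  near F => h; rewrite -(subrKA (h x)).
  rewrite (le_trans (ler_normD _ _))// lerD//; last first.
    by rewrite distrC; near: h.
  rewrite (_ : g x - h x = (g - h) x)// (le_trans (ler_norm_bop _ _))// ler_wpM2r// ltW//.
  have : ball g e h by near: h.
  by rewrite -ball_normE.
have bf : f \in @bounded_linear R V W.
  apply/asboolP; split => //.
  have [g Fg] := Fc _ ltr01.
  exists (`|g| + 1) => x.
  rewrite -[f x](subKr (g x)) (le_trans (ler_normB _ _))// mulrDl.
  by rewrite lerD// ?ler_norm_bop// fle.
apply/cvg_ex; exists (Bop bf); apply/cvg_ballP => e e0.
have e2 : 0 < e / 4 by rewrite divr_gt0.
have [g Fg] := Fc _ e2.
near=> h; rewrite -ball_normE/=.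
have gh : ball g (e / 4) h by near: h.
have -> : Bop bf - h = (g - h) - (g - Bop bf) by rewrite opprB [RHS]addrC subrKA.
rewrite (le_lt_trans (ler_normB _ _))//.
rewrite (@le_lt_trans _ _ (e / 4 + e / 4))//.
  rewrite lerD//; first by move: gh; rewrite -ball_normE => /ltW.
  by apply: bop_norm_le; [exact: ltW|move=> x; exact: fle].
by lra.
Unshelve. all: by end_near. Qed.

HB.instance Definition _ := Uniform_isComplete.Build (bop V W) bop_complete.

End bounded_operators_complete.

Section hahn_banach.
Variables (R : realType) (V : lmodType R) (p : V -> R).
Hypothesis pD : forall x y, p (x + y) <= p x + p y.
Hypothesis pZ : forall (a : R) x, 0 <= a -> p (a *: x) = a * p x.

Let lgraph (G : set (V * R)) := forall (a : R) u v, G u -> G v ->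
  G (a *: u.1 + v.1, a * u.2 + v.2).
Let dgraph (G : set (V * R)) := forall u, G u -> u.2 <= p u.1.

Let extend_graph (G : set (V * R)) v : G !=set0 -> lgraph G -> dgraph G ->
  exists2 r : R, lgraph [set u | exists2 w, G w & exists a,
     u = (w.1 + a *: v, w.2 + a * r)] &
  dgraph [set u | exists2 w, G w & exists a, u = (w.1 + a *: v, w.2 + a * r)].
Proof.
move=> [w0 Gw0] lG dG.
have GZ (a : R) u : G u -> G (a *: u.1, a * u.2).
  move=> Gu; have /= := lG (-1) _ _ Gu Gu.
  rewrite scaleN1r mulN1r !addNr => G0.
  by have /= := lG a _ _ Gu G0; rewrite !addr0.
pose S := [set w.2 - p (w.1 - v) | w in G].
have Sub w : G w -> ubound S (p (w.1 + v) - w.2).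
  move=> Gw _ [u Gu <-].
  rewrite lerBlDr addrAC -lerBlDr opprK addrC.
  have /= := dG _ (lG 1 _ _ Gu Gw); rewrite scale1r mul1r addrC => /le_trans -> //.
  rewrite [leRHS](_ : _ = p (w.1 + v) + p (u.1 - v))//.
  by rewrite (le_trans _ (pD _ _))// addrACA subrr addr0 addrC.
have Sle w : G w -> w.2 - p (w.1 - v) <= sup S.
  move=> Gw; apply: ub_le_sup; last by exists w.
  by exists (p (w0.1 + v) - w0.2); exact: Sub.
have leS w : G w -> sup S <= p (w.1 + v) - w.2.
  by move=> Gw; apply: ge_sup; [exists (w0.2 - p (w0.1 - v)), w0|exact: Sub].
exists (sup S).
  move=> a _ _ [w Gw [b ->]] [w' Gw' [c ->]]; exists (a *: w.1 + w'.1, a * w.2 + w'.2).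
    exact: lG.
  exists (a * b + c); apply: congr2 => /=.
    by rewrite scalerDr scalerDl scalerA addrACA.
  by rewrite mulrDr mulrDl mulrA addrACA.
move=> _ [w Gw [a ->]] /=.
have [a0|a0|->] := ltgtP a 0; last 2 first.
- have := leS _ (GZ a^-1 _ Gw); rewrite /= => h.
  rewrite -lerBrDl -ler_pdivlMl// mulrBr (le_trans h)//.
  rewrite lerD2r -pZ ?invr_ge0 ?(ltW a0)//.
  by rewrite scalerDr scalerA mulVf ?gt_eqF// scale1r.
- by rewrite mul0r scale0r !addr0; exact: dG.
have na0 : 0 < - a by rewrite oppr_gt0.
have := Sle _ (GZ (- a)^-1 _ Gw); rewrite /= => h.
rewrite -lerBrDl -[a * _]opprK -mulNr lerNl opprB -ler_pdivrMl// mulrBr.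
rewrite (le_trans _ h)// lerD2l lerN2 -pZ ?invr_ge0 ?(ltW na0)//.
by rewrite scalerDr scalerA invrN mulNr mulVf ?lt_eqF// scaleN1r.
Qed.

Theorem hahn_banach (G0 : set (V * R)) : G0 !=set0 ->
  (forall (a : R) u v, G0 u -> G0 v -> G0 (a *: u.1 + v.1, a * u.2 + v.2)) ->
  (forall u, G0 u -> u.2 <= p u.1) ->
  exists phi : V -> R^o, [/\ linear phi, forall x, phi x <= p x &
    forall u, G0 u -> phi u.1 = u.2].
Proof.
move=> [u0 G0u0] lG0 dG0.
pose P := [set G | lgraph (G `|` G0) /\ dgraph (G `|` G0)].
have [F FP Ftot|A [[lA dA] Amax]] := @Zorn_bigcup _ P.
  split=> [a u v|u [[X FX Xu]|G0u]]; [|by have [_] := FP _ FX; apply; left|exact: dG0].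
  move=> [[X FX Xu]|Gu] [[Y FY Yv]|Gv].
  - have [XY|YX] := Ftot _ _ FX FY.
      have [/(_ a u v) h _] := FP _ FY.
      have [||?|?] := h; [left; exact: XY|by left|by left; exists Y|by right].
    have [/(_ a u v) h _] := FP _ FX.
    have [||?|?] := h; [by left|left; exact: YX|by left; exists X|by right].
  - have [/(_ a u v) h _] := FP _ FX.
    by have [||?|?] := h; [left|right|left; exists X|right].
  - have [/(_ a u v) h _] := FP _ FY.
    by have [||?|?] := h; [right|left|left; exists Y|right].
  - by right; exact: lG0.
set G := A `|` G0 in lA dA.
have Gne : G !=set0 by exists u0; right.
have Gtot v : exists r, G (v, r).
  have [r lr dr] := extend_graph v Gne lA dA.
  set G' := [set _ | _] in lr dr.
  have GG' : G `<=` G'.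
    by move=> w Gw; exists w => //; exists 0; rewrite scale0r mul0r !addr0 -surjective_pairing.
  have G'E : G' `|` G0 = G' by apply/setUidPl => u Gu; apply: GG'; right.
  have G00 : G (0, 0).
    have [w Gw] := Gne; have /= := lA (-1) _ _ Gw Gw.
    by rewrite scaleN1r mulN1r !addNr.
  exists r; apply: contrapT => nG.
  apply: (Amax G'); last by rewrite /P /= G'E.
  split; first by move=> u Au; apply: GG'; left.
  move=> G'A; apply: nG; left; apply: G'A; exists (0, 0) => //.
  by exists 1; rewrite /= scale1r mul1r !add0r.
pose phi v : R^o := sval (cid (Gtot v)).
have phiG v : G (v, phi v) by rewrite /phi; case: cid.
have Guniq u : G u -> u.2 = phi u.1.
  move=> Gu; have p0 : p 0 = 0 by rewrite -(scale0r 0) pZ// mul0r.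
  have /dA/= := lA (-1) _ _ Gu (phiG u.1).
  have /dA/= := lA (-1) _ _ (phiG u.1) Gu.
  rewrite !scaleN1r !mulN1r !addNr p0 => h1 h2; apply/eqP.
  by rewrite eq_le -subr_le0 addrC h1 -subr_le0 addrC h2.
exists phi; split => [a x y|x|u G0u].
- by have /Guniq/= <- := lA a _ _ (phiG x) (phiG y).
- exact: (dA _ (phiG x)).
- by rewrite (Guniq u)//; right.
Qed.

End hahn_banach.

Notation dual R V := (@bop R V R^o).
Notation bidual R V := (dual R (dual R V)).

Section duality.
Variables (R : realType) (V : normedModType R).

Lemma exists_norming (x : V) : exists2 phi : dual R V,
  phi x = `|x| & forall y, `|phi y| <= `|y|.
Proof.
have normZ (a : R) (y : V) : 0 <= a -> `|a *: y| = a * `|y|.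
  by move=> a0; rewrite normrZ ger0_norm.
pose G0 : set (V * R) := [set u | exists a : R, u = (a *: x, a * `|x|)].
have G0ne : G0 !=set0 by exists (0 *: x, 0 * `|x|), 0.
have lG0 (a : R) u v : G0 u -> G0 v -> G0 (a *: u.1 + v.1, a * u.2 + v.2).
  move=> [b ->] [c ->]; exists (a * b + c) => /=.
  by rewrite scalerA mulrA scalerDl mulrDl.
have dG0 u : G0 u -> u.2 <= `|u.1|.
  by move=> [a ->] /=; rewrite normrZ ler_wpM2r// ler_norm.
have [phi [lphi phi_le phiE]] :=
  hahn_banach (@ler_normD R V) normZ G0ne lG0 dG0.
have phiN y : phi (- y) = - phi y.
  have phiB := zmod_morphism_linear lphi.
  have phi0 : phi 0 = 0 by rewrite -[X in phi X](subrr 0) phiB subrr.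
  by rewrite -[- y]add0r phiB phi0 add0r.
have phi_norm y : `|phi y| <= `|y|.
  by rewrite ler_norml phi_le andbT lerNl -phiN -normrN.
have bphi : phi \in @bounded_linear R V R^o.
  by apply/asboolP; split => //; exists 1 => y; rewrite mul1r.
exists (Bop bphi) => //=.
by have := phiE (x, `|x|); apply; exists 1; rewrite scale1r mul1r.
Qed.

Lemma canon_bounded_linear (x : V) :
  (fun phi : dual R V => phi x) \in @bounded_linear R (dual R V) R^o.
Proof.
apply/asboolP; split => //; exists `|x| => phi; rewrite mulrC.
exact: ler_norm_bop.
Qed.

Definition canon (x : V) : bidual R V := Bop (canon_bounded_linear x).

Lemma canon_linear : linear canon.
Proof. by move=> a x y; apply: bopP => phi /=; rewrite linearP. Qed.

HB.instance Definition _ :=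
  GRing.isLinear.Build R V (bidual R V) *:%R canon canon_linear.

Lemma canon_norm (x : V) : `|canon x| = `|x|.
Proof.
apply/eqP; rewrite eq_le; apply/andP; split.
  by apply: bop_norm_le => // phi; rewrite mulrC; exact: (ler_norm_bop phi x).
have [phi phix phi1] := exists_norming x.
have phi_le1 : `|phi| <= 1 by apply: bop_norm_le => // y; rewrite mul1r.
have := ler_norm_bop (canon x) phi; rewrite /= phix normr_id => /le_trans; apply.
by rewrite ler_piMr.
Qed.

End duality.

(* The completion of V is the closure of its canonical image in the bidual,
   with the norm of the bidual. *)
Definition in_completion {R : realType} {V : normedModType R}
    : {pred bidual R V} := fun u => `[< closure (range (@canon R V)) u >].

Section completion.
Variables (R : realType) (V : normedModType R).

Lemma in_completionP (u : bidual R V) : reflect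
  (forall e : R, 0 < e -> exists x : V, `|u - canon x| < e)
  (u \in @in_completion R V).
Proof.
apply: (iffP (asboolP _)) => [clu e e0|apxu U /nbhs_ballP[e /= e0 eU]].
  have [_ [[x _ <-]]] := clu _ (nbhsx_ballx u e e0).
  by rewrite -ball_normE/= => xe; exists x.
have [x xe] := apxu _ e0; exists (canon x); split; first by exists x.
by apply: eU; rewrite -ball_normE.
Qed.

Lemma in_completion_canon (x : V) : canon x \in @in_completion R V.
Proof. by apply/in_completionP => e e0; exists x; rewrite subrr normr0. Qed.

Lemma in_completion_submod_closed : submod_closed (@in_completion R V).
Proof.
split; first by rewrite -(linear0 (@canon R V)) in_completion_canon.
move=> a u v /in_completionP uP /in_completionP vP; apply/in_completionP => e e0.
have a1 : 0 < `|a| + 1 by rewrite ltr_wpDl.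
have d0 : 0 < (e / 2) / (`|a| + 1) by rewrite !divr_gt0.
have [x ux] := uP _ d0.
have [y vy] := vP _ (divr_gt0 e0 (ltr0n R 2)).
exists (a *: x + y); rewrite linearP/= opprD addrACA -scalerBr.
rewrite (le_lt_trans (ler_normD _ _))// normrZ [ltRHS](splitr e) ltr_leD//.
  rewrite (@le_lt_trans _ _ ((`|a| + 1) * `|u - canon x|)) ?ler_wpM2r ?lerDl//.
  by rewrite mulrC -ltr_pdivlMr.
exact: ltW.
Qed.

HB.instance Definition _ := GRing.isSubmodClosed.Build _ _
  (@in_completion R V) in_completion_submod_closed.

Record completion := Completion {
  completion_val :> bidual R V ;
  completion_valP : completion_val \in @in_completion R V }.

HB.instance Definition _ := [isSub of completion for completion_val].
HB.instance Definition _ := [Choice of completion by <:].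
HB.instance Definition _ := [SubChoice_isSubLmodule of completion by <:].

Definition completion_norm (u : completion) : R := `|completion_val u|.

Let normD u v : completion_norm (u + v) <= completion_norm u + completion_norm v.
Proof. exact: ler_normD. Qed.

Let normZ (a : R) u : completion_norm (a *: u) = `|a| * completion_norm u.
Proof. exact: normrZ. Qed.

Let norm_eq0 u : completion_norm u = 0 -> u = 0.
Proof. by move=> /normr0_eq0 u0; exact: val_inj. Qed.

HB.instance Definition _ :=
  Lmodule_isNormed.Build R completion normD normZ norm_eq0.

Lemma completion_complete (F : set_system completion) :
  ProperFilter F -> cauchy F -> cvg F.
Proof.
move=> FF /cauchyP Fc.
have /cvg_ex[l Fl] : cvg (completion_val @ F).
  apply: cauchy_cvg; apply: cauchy_exP => e e0.
  have [u Fu] := Fc _ e0; exists (completion_val u).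
  change (F [set v : completion | ball (completion_val u) e (completion_val v)]).
  by apply: filterS Fu => v; rewrite -!ball_normE.
have lP : l \in @in_completion R V.
  apply/in_completionP => e e0.
  have e2 : 0 < e / 2 by rewrite divr_gt0.
  have /cvgrPdist_lt/(_ _ e2) le2 := Fl.
  near F => v.
  have /in_completionP/(_ _ e2)[x vx] := completion_valP v.
  exists x; rewrite -(subrKA (completion_val v)).
  rewrite (le_lt_trans (ler_normD _ _))// [ltRHS](splitr e) ltrD//.
  by near: v.
apply/cvg_ex; exists (Completion lP); apply/cvgrPdist_lt => e e0.
by have /cvgrPdist_lt/(_ _ e0) := Fl.
Unshelve. all: by end_near. Qed.

HB.instance Definition _ :=
  Uniform_isComplete.Build completion completion_complete.

Definition to_completion (x : V) : completion :=
  Completion (in_completion_canon x).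

Lemma to_completion_norm (x : V) : `|to_completion x| = `|x|.
Proof. exact: canon_norm. Qed.

Lemma dense_to_completion : dense (range to_completion).
Proof.
move=> O [u Ou] oO.
have /nbhs_ballP[e /= e0 eO] : nbhs u O by exact: open_nbhs_nbhs.
have /in_completionP/(_ _ e0)[x ux] := completion_valP u.
exists (to_completion x); split; last by exists x.
by apply: eO; rewrite -ball_normE.
Qed.

End completion.

Lemma dualZ (R : realType) (V : normedModType R) (phi : dual R V) (a : R) x :
  phi (a *: x) = a * phi x.
Proof. exact: (linearZ_LR phi). Qed.

Section separation.
Variables (R : realType) (X Y : normedModType R).

Lemma span_or_separated n (x : 'I_n -> X) (x0 : X) :
  (exists c : 'I_n -> R, x0 = \sum_(i < n) c i *: x i) \/
  (exists2 phi : dual R X, phi x0 = 1 & forall i, phi (x i) = 0).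
Proof.
elim: n x x0 => [|n IHn] x x0.
  have [->|x0N] := eqVneq x0 0; first by left; exists (fun=> 0); rewrite big_ord0.
  right; have [phi phix _] := exists_norming x0.
  exists (`|x0|^-1 *: phi); last by case.
  by rewrite bopZ phix /GRing.scale/= mulVf// normr_eq0.
pose x' i := x (lift ord0 i).
have [[c cE]|[phi1 phi1x phi1x']] := IHn x' (x ord0).
  have [[d dE]|[phi phix0 phix']] := IHn x' x0.
    left; exists (fun i => if unlift ord0 i is Some j then d j else 0).
    rewrite big_ord_recl unlift_none scale0r add0r dE.
    by apply: eq_bigr => i _; rewrite liftK.
  right; exists phi => // i; case: (unliftP ord0 i) => [j ->|->]; first exact: phix'.
  by rewrite cE linear_sum big1// => j _; rewrite /= dualZ phix' mulr0.
have [[d dE]|[phi phix0 phix']] := IHn x' (x0 - phi1 x0 *: x ord0).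
  left; exists (fun i => if unlift ord0 i is Some j then d j else phi1 x0).
  rewrite big_ord_recl unlift_none -[LHS](subrK (phi1 x0 *: x ord0)) addrC dE.
  by congr (_ + _); apply: eq_bigr => i _; rewrite liftK.
right; exists (phi - phi (x ord0) *: phi1).
  rewrite bopB bopZ -[RHS]phix0 [RHS]raddfB/= dualZ.
  by rewrite /GRing.scale/= [X in _ - X = _]mulrC.
move=> i; rewrite bopB bopZ; case: (unliftP ord0 i) => [j ->|->].
  by rewrite phix' phi1x' scaler0 subr0.
by rewrite phi1x /GRing.scale/= mulr1 subrr.
Qed.

Lemma rank_one_forms_separate n (x : 'I_n -> X) (y : 'I_n -> Y) :
  (forall (phi : dual R X) (psi : dual R Y),
     \sum_(i < n) phi (x i) * psi (y i) = 0) ->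
  forall B : {bilinear X -> Y -> R^o}, \sum_(i < n) B (x i) (y i) = 0.
Proof.
elim: n x y => [|n IHn] x y xy B; first by rewrite big_ord0.
pose x' i := x (lift ord0 i); pose y' i := y (lift ord0 i).
have [[c cE]|[phi phix phix']] := span_or_separated x' (x ord0).
  have sumE (C : {bilinear X -> Y -> R^o}) : \sum_(i < n.+1) C (x i) (y i) =
      \sum_(i < n) C (x' i) (y' i + c i *: y ord0).
    rewrite big_ord_recl cE linear_sumlz -big_split/=; apply: eq_bigr => i _.
    by rewrite linearDr linearZl_LR linearZr_LR addrC.
  rewrite sumE; apply: IHn => phi psi; rewrite -[RHS](xy phi psi).
  rewrite [RHS]big_ord_recl cE linear_sum mulr_suml -big_split/=.
  apply: eq_bigr => i _; rewrite linearD /= !dualZ.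
  by rewrite mulrDr addrC mulrCA mulrA.
have y0 : y ord0 = 0.
  apply/eqP; apply: contrapT => /negP y0.
  have [psi psiy _] := exists_norming (y ord0).
  have := xy phi psi; rewrite big_ord_recl phix mul1r big1 ?addr0.
    by rewrite psiy => /normr0_eq0/eqP; apply/negP.
  by move=> i _; rewrite phix' mul0r.
rewrite big_ord_recl y0 linear0r add0r; apply: IHn => phi1 psi.
by rewrite -[RHS](xy phi1 psi) [RHS]big_ord_recl y0 linear0 mulr0 add0r.
Qed.

End separation.

(* The algebraic tensor product is realised inside the linear functionals on
   the space of all (not only the bounded) bilinear forms on X * Y: the list s
   of pairs (x_i, y_i) represents the sum of the elementary tensors
   x_i (x) y_i, and two lists represent the same tensor iff every bilinear form
   takes the same total value on them. *)
Definition tensor_sum {R : realType} {X Y : normedModType R} (s : seq (X * Y))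
    : {bilinear X -> Y -> R^o} -> R^o :=
  fun B => \sum_(p <- s) B p.1 p.2.

Definition is_tensor {R : realType} {X Y : normedModType R}
    : {pred {bilinear X -> Y -> R^o} -> R^o} :=
  fun u => `[< exists s : seq (X * Y), u = tensor_sum s >].

Section tensor_product.
Variables (R : realType) (X Y : normedModType R).

Record tensor := Tensor {
  tensor_val :> {bilinear X -> Y -> R^o} -> R^o ;
  tensor_valP : tensor_val \in @is_tensor R X Y }.

HB.instance Definition _ := [isSub of tensor for tensor_val].
HB.instance Definition _ := [Choice of tensor by <:].

Lemma tensor_sum_cat (s1 s2 : seq (X * Y)) :
  tensor_sum (s1 ++ s2) = tensor_sum s1 + tensor_sum s2.
Proof. by apply/funext => B; rewrite /tensor_sum big_cat. Qed.

Definition scale_rep (a : R) (s : seq (X * Y)) := [seq (a *: p.1, p.2) | p <- s].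

Lemma tensor_sum_scale a (s : seq (X * Y)) :
  tensor_sum (scale_rep a s) = a *: tensor_sum s.
Proof.
apply/funext => B; rewrite /tensor_sum big_map.
rewrite [RHS](_ : _ = a *: \sum_(p <- s) B p.1 p.2)// scaler_sumr.
by apply: eq_bigr => p _; rewrite /= linearZl_LR.
Qed.

Lemma is_tensor_submod_closed : submod_closed (@is_tensor R X Y).
Proof.
split.
  by apply/asboolP; exists [::]; apply/funext => B; rewrite /tensor_sum big_nil.
move=> a _ _ /asboolP[s ->] /asboolP[t ->]; apply/asboolP.
by exists (scale_rep a s ++ t); rewrite tensor_sum_cat tensor_sum_scale.
Qed.

HB.instance Definition _ := GRing.isSubmodClosed.Build _ _
  (@is_tensor R X Y) is_tensor_submod_closed.
HB.instance Definition _ := [SubChoice_isSubLmodule of tensor by <:].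

Definition rep_cost (s : seq (X * Y)) : R := \sum_(p <- s) `|p.1| * `|p.2|.

Definition proj_norm (u : tensor) : R :=
  inf [set rep_cost s | s in [set s | tensor_val u = tensor_sum s]].

Let tensor_rep (u : tensor) : exists s, tensor_val u = tensor_sum s.
Proof. by case: u => u /= /asboolP. Qed.

Lemma rep_cost_ge0 s : 0 <= rep_cost s.
Proof. by apply: sumr_ge0 => p _; rewrite mulr_ge0. Qed.

Let costs_ne (u : tensor) :
  [set rep_cost s | s in [set s | tensor_val u = tensor_sum s]] !=set0.
Proof. by have [s us] := tensor_rep u; exists (rep_cost s), s. Qed.

Lemma proj_norm_ge0 u : 0 <= proj_norm u.
Proof.
by apply: lb_le_inf => // _ [s _ <-]; exact: rep_cost_ge0.
Qed.

Lemma proj_norm_le (u : tensor) s :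
  tensor_val u = tensor_sum s -> proj_norm u <= rep_cost s.
Proof.
move=> us; apply: ge_inf; last by exists s.
by exists 0 => _ [t _ <-]; exact: rep_cost_ge0.
Qed.

Lemma proj_norm_adherent (u : tensor) e : 0 < e ->
  exists2 s, tensor_val u = tensor_sum s & rep_cost s < proj_norm u + e.
Proof.
move=> e0.
have hinf : has_inf [set rep_cost s | s in [set s | tensor_val u = tensor_sum s]].
  by split => //; exists 0 => _ [t _ <-]; exact: rep_cost_ge0.
by have [_ [s us <-] ?] := inf_adherent e0 hinf; exists s.
Qed.

Let proj_normD u v : proj_norm (u + v) <= proj_norm u + proj_norm v.
Proof.
apply/ler_addgt0Pr => e e0.
have e2 : 0 < e / 2 by rewrite divr_gt0.
have [s us su] := proj_norm_adherent u e2.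
have [t vt tv] := proj_norm_adherent v e2.
rewrite (@le_trans _ _ (rep_cost (s ++ t)))//.
  by apply: proj_norm_le; rewrite tensor_sum_cat -us -vt.
rewrite /rep_cost big_cat/= [X in _ <= _ + X]splitr [leRHS]addrACA.
by rewrite lerD// ltW.
Qed.

Let proj_normZ_le (a : R) u : proj_norm (a *: u) <= `|a| * proj_norm u.
Proof.
apply/ler_addgt0Pr => e e0.
have a1 : 0 < `|a| + 1 by rewrite ltr_wpDl.
have [s us su] := proj_norm_adherent u (divr_gt0 e0 a1).
rewrite (@le_trans _ _ (rep_cost (scale_rep a s)))//.
  by apply: proj_norm_le; rewrite tensor_sum_scale -us.
rewrite [leLHS](_ : _ = `|a| * rep_cost s); last first.
  rewrite /rep_cost big_map mulr_sumr; apply: eq_bigr => p _ /=.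
  by rewrite normrZ mulrA.
rewrite (le_trans (ler_wpM2l _ (ltW su)))// mulrDr lerD2l.
by rewrite mulrCA ler_piMr ?ltW// ltr_pdivrMr// mul1r ltrDl.
Qed.

Let proj_normZ (a : R) u : proj_norm (a *: u) = `|a| * proj_norm u.
Proof.
apply/eqP; rewrite eq_le proj_normZ_le/=.
have [->|a0] := eqVneq a 0; first by rewrite normr0 mul0r proj_norm_ge0.
rewrite -ler_pdivlMl ?normr_gt0// -normfV.
by rewrite (le_trans _ (proj_normZ_le _ _))// scalerA mulVf// scale1r.
Qed.

Let proj_norm_eq0 u : proj_norm u = 0 -> u = 0.
Proof.
move=> u0; have [s us] := tensor_rep u.
apply: val_inj; rewrite /= us; apply/funext => B; rewrite /tensor_sum.
rewrite (big_nth (0, 0)) big_mkord.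
apply: (rank_one_forms_separate (x := fun i : 'I_(size s) => (nth (0, 0) s i).1)
  (y := fun i => (nth (0, 0) s i).2)) => phi psi.
pose C (x : X) (y : Y) : R^o := phi x * psi y.
have bC : bilinear_for *:%R *:%R C.
  split => [y a x x'|x a y y']; rewrite /C linearP.
    by rewrite mulrDl -mulrA.
  by rewrite mulrDr; congr (_ + _); exact: mulrCA.
pose D : {bilinear X -> Y -> R^o} := HB.pack C (bilinear_isBilinear.Build _ _ _ _ _ _ C bC).
have -> : \sum_(i < size s) phi (nth (0, 0) s i).1 * psi (nth (0, 0) s i).2 =
    tensor_val u D.
  by rewrite us /tensor_sum (big_nth (0, 0)) big_mkord.
apply/eqP; rewrite -normr_le0; apply/ler_addgt0Pr => e e0; rewrite add0r.
have c0 : 0 < `|phi| * `|psi| + 1 by rewrite ltr_wpDl// mulr_ge0.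
have [t ut tu] := proj_norm_adherent u (divr_gt0 e0 c0).
rewrite ut (@le_trans _ _ ((`|phi| * `|psi| + 1) * rep_cost t))//; last first.
  by rewrite mulrC -ler_pdivlMr//; move: tu; rewrite u0 add0r => /ltW.
rewrite (le_trans (ler_norm_sum _ _ _))// /rep_cost mulr_sumr; apply: ler_sum => p _.
rewrite /= normrM mulrDl mul1r (le_trans (ler_pM _ _ (ler_norm_bop _ _) (ler_norm_bop _ _)))//.
by rewrite mulrACA lerDl mulr_ge0.
Qed.

HB.instance Definition _ :=
  Lmodule_isNormed.Build R tensor proj_normD proj_normZ proj_norm_eq0.

Lemma tensor_normE (u : tensor) : `|u| = proj_norm u. Proof. by []. Qed.

Definition proj_tensor : completeNormedModType R := completion tensor.

End tensor_product.

Section banach_space_properties.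
Variables (R : realType).

Definition reflexive_space (V : normedModType R) :=
  range (@canon R V) = [set: bidual R V].

(* The sum of canon @` V and Z is direct: canon x + z = 0 forces
   `|canon x| + `|z| = 0. *)
Definition L_embedded (V : normedModType R) :=
  exists Z : {pred bidual R V}, [/\ submod_closed Z,
    forall phi : bidual R V, exists (x : V) (z : bidual R V),
      z \in Z /\ phi = canon x + z &
    forall (x : V) (z : bidual R V),
      z \in Z -> `|canon x + z| = `|canon x| + `|z|].

Definition finite_dim_subspace (V : lmodType R) (E : set V) :=
  exists (n : nat) (e : 'I_n -> V),
    E = [set x | exists c : 'I_n -> R, x = \sum_(i < n) c i *: e i].

Definition directed (I : Type) (le : I -> I -> Prop) :=
  [/\ exists i : I, True, forall i, le i i,
    forall i j k, le i j -> le j k -> le i k &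
    forall i j, exists2 k, le i k & le j k].

(* The filter along which a net indexed by (I, le) converges. *)
Definition tails (I : Type) (le : I -> I -> Prop) : set_system I :=
  filter_from [set: I] (fun i => [set j | le i j]).

Definition metric_approximation_property (W : normedModType R) :=
  exists (I : Type) (le : I -> I -> Prop) (S : I -> bop W W),
    [/\ directed le,
      forall i, finite_dim_subspace (range (S i)),
      forall i, `|S i| <= 1 &
      forall w : W, S i w @[i --> tails le] --> w].

Definition octahedral (W : normedModType R) :=
  forall (E : set W) (e : R), finite_dim_subspace E -> 0 < e ->
  exists2 y : W, `|y| = 1 &
    forall (x : W) (l : R), E x -> (1 - e) * (`|x| + `|l|) <= `|x + l *: y|.

End banach_space_properties.

(* Main.v *)
(* Primes denote duals.  Write X'' = X (+)_1 Z and pick z in Z and y0 in Y of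
   norm one.  For u in X (x)_pi Y of norm one and tau a functional norming u,
   the form
     B(x + z1, y) = tau(x (x) y) + h(z1) psi0(y)      (x in X, z1 in Z)
   on X'' x Y, with h(z) = psi0(y0) = 1, has norm at most one because the sum
   is an l_1-sum, and it takes the value 2 at u + z (x) y0.  The approximation
   property makes B, up to epsilon, a finite-rank form sum_k psi_k (x) f_k with
   f_k in X'''.  The values of such a form on X'' (x) Y are bounded by those of
   contractive operators T : Y -> X', by Hahn-Banach in l_infty^m(X'), where m
   is the size of a net of the unit ball of Y relative to the psi_k.  So some
   contractive T almost norms u and has z(T y0) almost 1.  Doing this for a
   finite net of the unit sphere of the given finite-dimensional subspace,
   Helly's theorem replaces z by a single x1 in X with (T y0)(x1) almost 1 for
   all the operators T found, and x1 (x) y0 is the required direction. *)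
From HB Require Import structures.
From Pilot Require Import Defs.
From mathcomp Require Import all_boot all_order all_algebra sesquilinear.
From mathcomp Require Import boolp classical_sets reals topology normedtype.
From mathcomp Require Import ring lra.

Set Implicit Arguments.
Unset Strict Implicit.
Unset Printing Implicit Defensive.

Import Order.TTheory GRing.Theory Num.Theory.
Import numFieldNormedType.Exports.
(* [canon] also names an operation of MathComp's generic quotients. *)
Import Pilot.Defs.

Local Open Scope classical_set_scope.
Local Open Scope ring_scope.

(** * Functionals and operators defined by bounded forms *)

Section BoundedOperators.
Context {R : realType}.
Implicit Types V W : normedModType R.

Lemma bop_of_linear V W (f : V -> W) (C : R) : 0 <= C ->
  linear f -> (forall x, `|f x| <= C * `|x|) ->
  exists2 T : bop V W, T =1 f & `|T| <= C.
Proof.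
move=> C0 lf fC.
have fP : f \in @bounded_linear R V W by apply/asboolP; split => //; exists C.
by exists (Bop fP) => //; apply: bop_norm_le.
Qed.

Lemma dual_of_linear V (f : V -> R) (C : R) : 0 <= C ->
  (forall a x y, f (a *: x + y) = a * f x + f y) ->
  (forall x, `|f x| <= C * `|x|) ->
  exists2 phi : dual R V, phi =1 f & `|phi| <= C.
Proof. by move=> C0 lf fC; apply: (@bop_of_linear V R^o f C). Qed.

(** Currying; it lets the form on X'' x Y be handled as an operator from Y into X'''. *)
Lemma bop_of_bilinear V W (b : V -> W -> R) (C : R) : 0 <= C ->
  (forall a x x' y, b (a *: x + x') y = a * b x y + b x' y) ->
  (forall a x y y', b x (a *: y + y') = a * b x y + b x y') ->
  (forall x y, `|b x y| <= C * `|x| * `|y|) ->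
  exists2 T : bop V (dual R W), (forall x y, T x y = b x y) & `|T| <= C.
Proof.
move=> C0 bl br bC.
have fP x : {phi : dual R W | phi =1 b x /\ `|phi| <= C * `|x|}.
  apply: cid; have Cx : 0 <= C * `|x| by rewrite mulr_ge0.
  have [phi phiE phiC] := dual_of_linear Cx (fun a => br a x) (bC x).
  by exists phi.
pose f x := sval (fP x).
have fE x y : f x y = b x y by rewrite /f; case: (fP x) => ? [].
have [a x x'|x|T TE TC] := @bop_of_linear V (dual R W) f C C0.
- by apply: bopP => y; rewrite bopD bopZ !fE bl.
- by rewrite /f; case: (fP x) => ? [].
by exists T => // x y; rewrite TE fE.
Qed.

(** The norm is a supremum of absolute values; passing from [x] to [- x] fixes the sign. *)
Lemma dual_norm_adherent V (phi : dual R V) (e : R) : 0 < e ->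
  exists2 x, `|x| <= 1 & `|phi| - e < phi x.
Proof.
move=> e0.
have ne : has_sup [set `|phi x| | x in [set x : V | `|x| <= 1]].
  split; first by exists `|phi 0|, 0; rewrite //= normr0.
  exists `|phi| => _ [x /= x1 <-].
  by rewrite (le_trans (ler_norm_bop _ _))// ler_piMr.
have [_ [x /= x1 <-] xe] := sup_adherent e0 ne.
have [p0|p0] := leP 0 (phi x).
  by exists x => //; rewrite -[ltRHS]ger0_norm.
exists (- x); first by rewrite normrN.
by rewrite linearN -[ltRHS]ltr0_norm.
Qed.

Lemma dual_bound V (phi : dual R V) (M : R) :
  (forall y, `|y| <= 1 -> phi y <= M) -> `|phi| <= M.
Proof.
move=> phiM; apply/ler_addgt0Pr => e e0.
have [y y1 /ltW] := dual_norm_adherent phi e0.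
by rewrite lerBlDr => /le_trans -> //; rewrite lerD2r phiM.
Qed.

End BoundedOperators.

(** * Coordinate functionals and finite nets *)

Section FiniteDimension.
Context {R : realType}.

(** The [e i] may be dependent, so there need be no dual basis; functionals that recover each vector
    of the span are enough. By induction, a first vector in the span of the others gets the
    functional 0, any other one a separating functional. *)
Lemma span_coordinates (V : normedModType R) n (e : 'I_n -> V) :
  exists phi : 'I_n -> dual R V, forall c : 'I_n -> R,
    \sum_(i < n) c i *: e i =
    \sum_(i < n) phi i (\sum_(j < n) c j *: e j) *: e i.
Proof.
elim: n e => [|n IHn] e; first by exists (fun=> 0) => c; rewrite !big_ord0.
pose e' i := e (lift ord0 i).
have [phi' phi'E] := IHn e'.
have [[d dE]|[phi phi0 phie']] := @span_or_separated R V n e' (e ord0).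
  exists (fun i => if unlift ord0 i is Some j then phi' j else 0) => c.
  rewrite [RHS]big_ord_recl unlift_none bop0 scale0r add0r.
  under [RHS]eq_bigr do rewrite liftK.
  rewrite big_ord_recl dE scaler_sumr -big_split/=.
  under eq_bigr do rewrite scalerA -scalerDl.
  exact: phi'E.
(* The earlier coordinates are taken of [x - phi x *: e ord0], which is back in the span of [e']. *)
exists (fun i => if unlift ord0 i is Some j then phi' j - phi' j (e ord0) *: phi
                 else phi) => c.
set x := \sum_(i < _) _.
have xE : x = c ord0 *: e ord0 + \sum_(i < n) c (lift ord0 i) *: e' i.
  by rewrite /x big_ord_recl.
have phix : phi x = c ord0.
  rewrite xE linearD linear_sum /= dualZ phi0 mulr1 big1 ?addr0// => i _.
  by rewrite dualZ phie' mulr0.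
rewrite big_ord_recl unlift_none phix {1}xE; congr (_ + _).
rewrite phi'E; apply: eq_bigr => i _; rewrite liftK bopB bopZ phix.
congr (_ *: _); rewrite xE linearD/= dualZ.
by rewrite /GRing.scale/= [X in _ - X]mulrC addrAC subrr add0r.
Qed.

(** The values [f i x] lie in [[-M, M]], which is cut into intervals of length [d]. One point of [A]
    is chosen in each cell of the resulting grid that [A] meets; points of one cell have values
    within [d]. *)
Lemma finite_net (T : Type) n (f : 'I_n -> T -> R) (A : set T) (M d : R) :
  (forall i x, A x -> `|f i x| <= M) -> 0 < d ->
  exists (K : finType) (u : K -> T), (forall k, A (u k)) /\
    forall x, A x -> exists k, forall i, `|f i x - f i (u k)| <= d.
Proof.
move=> fM d0.
pose t x i := Num.trunc ((f i x + M) / d).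
pose N := Num.trunc ((M + M) / d).
pose cell x : {ffun 'I_n -> 'I_N.+1} := [ffun i => inord (t x i)].
pose K : finType := {c : {ffun 'I_n -> 'I_N.+1} | `[< exists2 x, A x & cell x = c >]}.
have uP (k : K) : {x | A x & cell x = val k}.
  by apply: cid2; apply/asboolP; exact: valP k.
exists K, (fun k => s2val (uP k)); split=> [k|x Ax]; first by case: (uP k).
have xK : `[< exists2 y, A y & cell y = cell x >] by apply/asboolP; exists x.
exists (exist _ (cell x) xK) => i; case: (uP _) => y Ay /= /ffunP/(_ i).
have tN z : A z -> (t z i < N.+1)%N.
  move=> Az; rewrite ltnS le_truncn// ler_pM2r ?invr_gt0//.
  by rewrite lerD2r; have := fM i _ Az; rewrite ler_norml => /andP[].
rewrite !ffunE => /(congr1 val) /=; rewrite !inordK ?tN// => txy.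
have t0 z : A z -> 0 <= (f i z + M) / d.
  move=> Az; rewrite divr_ge0 ?(ltW d0)// -lerBlDr sub0r.
  by have := fM i _ Az; rewrite ler_norml => /andP[].
have /andP[] := truncn_itv (t0 _ Ay); have /andP[] := truncn_itv (t0 _ Ax).
rewrite -/(t x i) -/(t y i) txy !ler_pdivlMr// !ltr_pdivrMr// -natr1 mulrDl mul1r.
set a := _ * d => h1 h2 h3 h4; rewrite ler_norml; apply/andP; split; lra.
Qed.

End FiniteDimension.

(** * Linear forms on a finite power of a space *)

Section FfunLinear.
Context {R : realType} {V : lmodType R} {K : finType}.

Definition ffun_at (c : K) (w : V) : {ffun K -> V} :=
  [ffun c' => if c' == c then w else 0].

Lemma sum_ffun_at (a : {ffun K -> V}) : a = \sum_c ffun_at c (a c).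
Proof.
apply/ffunP => c; rewrite sum_ffunE (bigD1 c)//= ffunE eqxx big1 ?addr0//.
by move=> c' c'c; rewrite ffunE eq_sym (negbTE c'c).
Qed.

Lemma ffun_at_linear c : linear (ffun_at c).
Proof.
move=> a x y; apply/ffunP => c'; rewrite !ffunE.
by case: ifP => // _; rewrite scaler0 addr0.
Qed.

Lemma linear_form0 (phi : {ffun K -> V} -> R^o) : linear phi -> phi 0 = 0.
Proof.
move=> lphi; have := lphi (-1) 0 0; rewrite scaler0 addr0 => {1}->.
by rewrite scaleN1r addNr.
Qed.

Lemma linear_form_sum (phi : {ffun K -> V} -> R^o) (a : {ffun K -> V}) :
  linear phi -> phi a = \sum_c phi (ffun_at c (a c)).
Proof.
move=> lphi; rewrite {1}(sum_ffun_at a).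
apply: (big_morph phi) => [x y|]; last exact: linear_form0.
by rewrite -{1}(scale1r x) lphi scale1r.
Qed.

End FfunLinear.

(** * Hahn-Banach in finite powers: functionals on l_infty sums, Helly's theorem *)

Section Splitting.
Context {R : realType}.

(** The bound makes [Phi] a functional of norm at most [M] on the subspace of all [(L c g)_c] in
    l_infty^K(V). Hahn-Banach extends it, and the dual of l_infty^K(V) is l_1^K(V'). *)
Lemma split_functional (G : lmodType R) (V : normedModType R) (K : finType)
    (L : K -> G -> V) (Phi : G -> R) (M : R) :
  0 <= M -> (forall c, linear (L c)) ->
  (forall a g h, Phi (a *: g + h) = a * Phi g + Phi h) ->
  (forall g s, 0 <= s -> (forall c, `|L c g| <= s) -> Phi g <= M * s) ->
  exists2 v : K -> dual R V, \sum_c `|v c| <= M &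
    forall g, Phi g = \sum_c v c (L c g).
Proof.
move=> M0 lL lPhi PhiM.
pose nm (a : {ffun K -> V}) := \big[Num.max/0]_c `|a c|.
have nm0 (a : {ffun K -> V}) : 0 <= nm a by exact: bigmax_ge_id.
have le_nm (a : {ffun K -> V}) c : `|a c| <= nm a by exact: le_bigmax.
have nm_le (a : {ffun K -> V}) s : 0 <= s -> (forall c, `|a c| <= s) -> nm a <= s.
  by move=> s0 h; apply: bigmax_le.
have pD x y : M * nm (x + y) <= M * nm x + M * nm y.
  rewrite -mulrDr ler_wpM2l// nm_le ?addr_ge0// => c.
  by rewrite ffunE (le_trans (ler_normD _ _))// lerD.
have pZ_le (a : R) x : 0 <= a -> nm (a *: x) <= a * nm x.
  move=> a0; apply: nm_le => [|c]; first by rewrite mulr_ge0.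
  by rewrite ffunE normrZ ger0_norm// ler_wpM2l.
have pZ (a : R) x : 0 <= a -> M * nm (a *: x) = a * (M * nm x).
  rewrite le_eqVlt => /predU1P[<-|a0].
    rewrite scale0r mul0r; apply/eqP; rewrite mulf_eq0; apply/orP; right.
    by rewrite eq_le nm0 nm_le// => c; rewrite ffunE normr0.
  rewrite mulrCA; congr (_ * _); apply/eqP; rewrite eq_le pZ_le ?(ltW a0)//=.
  rewrite -ler_pdivlMl// -{1}(scale1r x) -(mulVf (lt0r_neq0 a0)) -scalerA.
  by rewrite pZ_le// invr_ge0 ltW.
(* A graph is used because distinct [g] may share all [L c g]; that [Phi] agrees on them follows
   from the domination by [M * nm]. *)
pose G0 : set ({ffun K -> V} * R) :=
  [set u | exists g, u = ([ffun c => L c g], Phi g)].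
have [|a _ _ [g ->] [h ->]|_ [g ->]|phi [lphi phile phiE]] :=
    hahn_banach (p := fun a => M * nm a) pD pZ (G0 := G0).
- by exists ([ffun c => L c 0], Phi 0), 0.
- exists (a *: g + h); rewrite /= lPhi; congr (_, _).
  by apply/ffunP => c; rewrite !ffunE lL.
- by apply: PhiM => // c; have := le_nm [ffun c => L c g] c; rewrite ffunE.
have vP c : {v : dual R V | v =1 phi \o ffun_at c}.
  apply: cid; have [a x y|x|v vE _] :=
    @dual_of_linear R V (phi \o ffun_at c) M M0; last by exists v.
    by rewrite /= ffun_at_linear lphi.
  have h y : phi (ffun_at c y) <= M * `|y|.
    rewrite (le_trans (phile _))// ler_wpM2l// nm_le// => c'.
    by rewrite ffunE; case: ifP => // _; rewrite normr0.
  rewrite /= ler_norml h andbT lerNl -(normrN x) (le_trans _ (h _))//.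
  have /= := lphi (-1) (ffun_at c x) 0.
  rewrite addr0 linear_form0// addr0 !scaleN1r => <-.
  have := ffun_at_linear c (-1) x 0; rewrite addr0 !scaleN1r => ->.
  suff -> : ffun_at c (0 : V) = 0 by rewrite addr0.
  by apply/ffunP => c'; rewrite !ffunE; case: ifP.
pose v c := sval (vP c).
have vE c x : v c x = phi (ffun_at c x) by rewrite /v; case: (vP c).
exists v; last first.
  move=> g; have := phiE _ (ex_intro _ g erefl); rewrite /= => <-.
  by rewrite linear_form_sum//; apply: eq_bigr => c _; rewrite vE ffunE.
(* Almost norming vectors for the [v c] form a single point of the l_infty unit ball, where [phi] is
   at most [M]. The [+ 1] keeps the denominator positive for empty [K]. *)
apply/ler_addgt0Pr => e e0.
have d0 : 0 < e / (#|K|%:R + 1) by rewrite divr_gt0// ltr_wpDl.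
have aP c : {x | `|x| <= 1 & `|v c| - e / (#|K|%:R + 1) < v c x}.
  by apply: cid2; exact: dual_norm_adherent.
pose a : {ffun K -> V} := [ffun c => s2val (aP c)].
have : phi a <= M.
  rewrite (le_trans (phile _))// ler_piMr// nm_le// => c.
  by rewrite ffunE; case: (aP c).
rewrite linear_form_sum// => aM; rewrite -lerBlDr (le_trans _ aM)//.
rewrite lerBlDr (@le_trans _ _ (\sum_c (phi (ffun_at c (a c)) + e / (#|K|%:R + 1))))//.
  apply: ler_sum => c _; rewrite -vE ffunE -lerBlDr.
  by case: (aP c) => x _ /= /ltW.
rewrite big_split/= lerD2l sumr_const -[leLHS]mulr_natl mulrCA ler_piMr ?ltW//.
by rewrite ltr_pdivrMr ?ltr_wpDl// mul1r ltrDl.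
Qed.

Lemma helly (X : normedModType R) (K : finType) (g : K -> dual R X)
    (xi : bidual R X) (e : R) : `|xi| <= 1 -> 0 < e ->
  exists2 x : X, `|x| <= 1 + e & forall c, `|g c x - xi (g c)| <= e.
Proof.
(* With this weight, a cost below [1 + e] forces the l_1 error to be at most [e]. *)
move=> xi1 e0; pose L := (1 + e) / e.
have L0 : 0 < L by rewrite divr_gt0// addr_gt0.
(* [p] below is, up to a factor, the gauge of {(g c x)_c : |x| <= 1} plus a
   small l_1-ball; the Hahn-Banach functional at (xi (g c))_c shows p <= 1
   there. *)
pose cost (v : {ffun K -> R^o}) x := `|x| + L * \sum_c `|v c - g c x|.
have cost0 v x : 0 <= cost v x.
  by rewrite addr_ge0// mulr_ge0 ?(ltW L0)// sumr_ge0.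
pose p v := inf [set cost v x | x in [set: X]].
have hinf v : has_inf [set cost v x | x in [set: X]].
  by split; [exists (cost v 0), 0|exists 0 => _ [x _ <-]].
have p_le v x : p v <= cost v x by apply: (ge_inf (hinf v).2); exists x.
have le_p (v : {ffun K -> R^o}) (r : R) : (forall x, r <= cost v x) -> r <= p v.
  by move=> h; apply: lb_le_inf; [exact: (hinf v).1|move=> _ [x _ <-]].
have p0 v : 0 <= p v by apply: (le_p) => x; exact: cost0.
have pD v w : p (v + w) <= p v + p w.
  rewrite -lerBlDl; apply: (le_p) => y; rewrite lerBlDl -lerBlDr.
  apply: (le_p) => x; rewrite lerBlDr (le_trans (p_le _ (x + y)))//.
  rewrite /cost addrACA -mulrDr lerD ?ler_normD// ler_wpM2l ?(ltW L0)//.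
  rewrite -big_split/=; apply: ler_sum => c _.
  by rewrite ffunE linearD opprD addrACA ler_normD.
have pZ_le (a : R) v : 0 < a -> p (a *: v) <= a * p v.
  move=> a0; rewrite mulrC -ler_pdivrMr//; apply: (le_p) => x.
  rewrite ler_pdivrMr// (le_trans (p_le _ (a *: x)))// mulrC.
  rewrite /cost normrZ gtr0_norm// mulrDr lerD2l mulrCA ler_wpM2l ?(ltW L0)//.
  rewrite mulr_sumr; apply: ler_sum => c _.
  by rewrite ffunE dualZ -mulrBr normrM gtr0_norm.
have pZ (a : R) v : 0 <= a -> p (a *: v) = a * p v.
  rewrite le_eqVlt => /predU1P[<-|a0].
    rewrite scale0r mul0r; apply/eqP; rewrite eq_le p0 andbT.
    rewrite (le_trans (p_le _ 0))// /cost normr0 add0r big1 ?mulr0// => c _.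
    by rewrite ffunE linear0 subrr normr0.
  apply/eqP; rewrite eq_le pZ_le//= -ler_pdivlMl//.
  rewrite -{1}(scale1r v) -(mulVf (lt0r_neq0 a0)) -scalerA.
  by rewrite pZ_le// invr_gt0.
pose v0 : {ffun K -> R^o} := [ffun c => xi (g c)].
pose G0 : set ({ffun K -> R^o} * R) := [set u | exists t : R, u = (t *: v0, t * p v0)].
have [|a _ _ [s ->] [t ->]|_ [t ->]|phi [lphi phile phiE]] :=
    hahn_banach pD pZ (G0 := G0).
- by exists (0 *: v0, 0 * p v0), 0.
- by exists (a * s + t); rewrite /= !(mulrDl, scalerDl) mulrA scalerA.
- rewrite /=; have [t0|t0] := leP 0 t; first by rewrite pZ.
  by rewrite (le_trans _ (p0 _))// mulr_le0_ge0// ltW.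
have phi0 : phi v0 = p v0.
  have := phiE (v0, p v0); apply; exists 1; by rewrite scale1r mul1r.
pose a c : R := phi (ffun_at c (1 : R^o)).
have phi_sum v : phi v = \sum_c a c * v c.
  rewrite linear_form_sum//; apply: eq_bigr => c _.
  have /= := lphi (v c) (ffun_at c (1 : R^o)) 0.
  rewrite addr0 linear_form0// addr0 [RHS]mulrC => <-; congr (phi _).
  apply/ffunP => c'; rewrite !ffunE /GRing.scale/=.
  by case: ifP => _; rewrite ?mulr1 ?mulr0.
(* [h] is [phi] pulled back along [x |-> (g c x)_c]. It is a contraction since that point costs only
   [|x|], and [phi v0 = xi h] gives [p v0 <= 1]. *)
pose h : dual R X := \sum_c a c *: g c.
have hE x : h x = phi [ffun c => g c x].
  rewrite phi_sum /h; under [RHS]eq_bigr do rewrite ffunE.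
  by apply: (big_morph (fun k : dual R X => k x)).
have h1 : `|h| <= 1.
  apply: dual_bound => x x1; rewrite hE (le_trans (phile _))//.
  rewrite (le_trans (p_le _ x))// /cost big1 ?mulr0 ?addr0// => c _.
  by rewrite ffunE subrr normr0.
have pv0 : p v0 <= 1.
  rewrite -phi0 phi_sum; have -> : \sum_c a c * v0 c = xi h.
    rewrite /h linear_sum/=; apply: eq_bigr => c _.
    by rewrite ffunE dualZ.
  rewrite (le_trans (ler_norm _))// (le_trans (ler_norm_bop _ _))//.
  by rewrite mulr_ile1.
have [_ [x _ <-] cx] := inf_adherent e0 (hinf v0).
have {cx} cx : cost v0 x < 1 + e by rewrite (lt_le_trans cx)// lerD2r.
have S0 : 0 <= \sum_c `|v0 c - g c x| by exact: sumr_ge0.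
exists x.
  by rewrite (le_trans _ (ltW cx))// /cost lerDl mulr_ge0// ltW.
move=> c; rewrite distrC.
have Se : \sum_c `|v0 c - g c x| <= e.
  have : L * \sum_c `|v0 c - g c x| <= 1 + e.
    by rewrite (le_trans _ (ltW cx))// /cost lerDr.
  by rewrite -ler_pdivlMl// /L invf_div divfK// gt_eqF// addr_gt0.
by rewrite (le_trans _ Se)// (bigD1 c)//= ffunE lerDl sumr_ge0.
Qed.

End Splitting.

(** * Finite-rank forms with coefficients in a bidual *)

Section FiniteRank.
Context {R : realType}.

Lemma bop_sum (V W : normedModType R) (I : Type) (r : seq I) (F : I -> bop V W) x :
  (\sum_(i <- r) F i) x = \sum_(i <- r) F i x.
Proof. exact: (big_morph (fun h : bop V W => h x)). Qed.

(** On a net of points [u c] of the unit ball of [Y], the norm of the operator given by [(g k)] is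
    nearly the maximum of the norms of its values there. So [split_functional] expresses the [W k]
    through functionals [v c] of total norm about [M], and on each of these the contractive form
    given by the [f k] is bounded directly. *)
Lemma dual_finite_rank_bound (V Y : normedModType R) n (psi : 'I_n -> dual R Y)
    (f : 'I_n -> bidual R V) (W : 'I_n -> dual R V) (M : R) :
  (forall v y, `|\sum_k psi k y * f k v| <= `|v| * `|y|) ->
  (forall g : 'I_n -> V, (forall y, `|\sum_k psi k y *: g k| <= `|y|) ->
     \sum_k W k (g k) <= M) ->
  \sum_k f k (W k) <= M.
Proof.
move=> f1 WM.
have M0 : 0 <= M.
  have := WM (fun=> 0); rewrite big1 => [|k _]; last by rewrite linear0.
  by apply=> y; rewrite big1 ?normr0// => k _; rewrite scaler0.
pose F : R := \sum_k `|f k| + 1.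
have F0 : 0 < F by rewrite ltr_wpDl// sumr_ge0.
have fF k : `|f k| <= F.
  by rewrite /F (bigD1 k)//= -addrA lerDl addr_ge0// sumr_ge0.
apply/ler_addgt0Pr => e e0.
(* The mesh is chosen to make [M * t <= M + e] below; the added ones cover [n = 0] and [M = 0]. *)
pose d := e / (F * (n%:R + 1) * (M + 1)).
have d0 : 0 < d by rewrite divr_gt0// !mulr_gt0// ltr_wpDl.
pose C : R := \sum_k `|psi k|.
have [i y /= y1|I [u [u1 uP]]] :=
    @finite_net R Y n (fun k y => psi k y) [set y | `|y| <= 1] C d _ d0.
  rewrite (le_trans (ler_norm_bop _ _))// (le_trans (ler_piMr _ y1))//.
  by rewrite /C (bigD1 i)//= lerDl sumr_ge0.
(* The components [F^-1 *: g k] control the error made when [y] is replaced by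
   a point of the net, even if the psi k are linearly dependent. *)
pose L (c : I + 'I_n) (g : {ffun 'I_n -> V}) : V :=
  match c with
  | inl c => \sum_k psi k (u c) *: g k
  | inr k => F^-1 *: g k
  end.
(* The factor lost on the net: if all components are at most [s], then [|g k| <= F * s], and moving
   [y] to a net point costs at most [n * d * F * s]. *)
pose t : R := 1 + n%:R * (d * F).
have t1 : 1 <= t by rewrite lerDl mulr_ge0 ?ler0n// mulr_ge0 ?ltW.
have Lt (g : {ffun 'I_n -> V}) (s : R) : (forall c, `|L c g| <= s) ->
    forall y, `|\sum_k psi k y *: g k| <= s * t * `|y|.
  move=> Ls.
  have gs k : `|g k| <= F * s.
    have := Ls (inr k); rewrite /= normrZ gtr0_norm ?invr_gt0//.
    by rewrite ler_pdivrMl.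
  have h y : `|y| <= 1 -> `|\sum_k psi k y *: g k| <= s * t.
    move=> y1; have [c cP] := uP _ y1.
    rewrite -(subrK (L (inl c) g) (\sum_k _)) (le_trans (ler_normD _ _))//.
    rewrite /t mulrDr mulr1 [leRHS]addrC lerD//.
    rewrite /= -sumrB (le_trans (ler_norm_sum _ _ _))//.
    apply: (@le_trans _ _ (\sum_(k < n) d * (F * s))).
      apply: ler_sum => k _; rewrite -scalerBl normrZ.
      by rewrite ler_pM.
    rewrite sumr_const card_ord -[leLHS]mulr_natl.
    by rewrite (mulrC s) -!mulrA.
  move=> y; have [->|y0] := eqVneq y 0.
    by rewrite normr0 mulr0 big1 ?normr0// => k _; rewrite linear0 scale0r.
  have y0' : 0 < `|y| by rewrite normr_gt0.
  have := h (`|y|^-1 *: y); rewrite normfZV// => /(_ (lexx _)).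
  under eq_bigr do rewrite dualZ -scalerA.
  rewrite -scaler_sumr normrZ gtr0_norm ?invr_gt0//.
  by rewrite ler_pdivrMl// mulrC.
have [||a g h|g s s0 Ls|v vM vE] := @split_functional R {ffun 'I_n -> V} V
    (I + 'I_n)%type L (fun g => \sum_k W k (g k)) (M * t).
- by rewrite mulr_ge0// (le_trans ler01).
- move=> [c|k] a g h /=; last by rewrite !ffunE scalerDr scalerA mulrC -scalerA.
  rewrite scaler_sumr -big_split/=; apply: eq_bigr => k _.
  by rewrite !ffunE scalerDr !scalerA mulrC.
- rewrite mulr_sumr -big_split/=; apply: eq_bigr => k _.
  by rewrite !ffunE linearP.
(* For [s = 0] the components [inr k] force [g k = 0]; otherwise the hypothesis applies to the tuple
   divided by [s * t]. *)
- have := Lt _ _ Ls; move: s0; rewrite le_eqVlt => /predU1P[s0|s0] gle.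
    rewrite -s0 mulr0 big1// => k _.
    have := Ls (inr k); rewrite -s0 /= normr_le0 scaler_eq0 invr_eq0.
    by rewrite gt_eqF//= => /eqP ->; rewrite linear0.
  have st0 : 0 < s * t by rewrite mulr_gt0// (lt_le_trans ltr01).
  have := WM (fun k => (s * t)^-1 *: g k).
  under [X in X <= M]eq_bigr do rewrite dualZ.
  rewrite -mulr_sumr ler_pdivrMl// => h.
  rewrite (le_trans (h _))//; last by rewrite [leRHS]mulrAC -mulrA mulrC (mulrC s).
  move=> y; under eq_bigr do rewrite scalerA mulrC -scalerA.
  by rewrite -scaler_sumr normrZ gtr0_norm ?invr_gt0// ler_pdivrMl.
(* Evaluation at the tuple with [w] in place [k] and 0 elsewhere isolates [W k]. *)
have Ww k w : W k w = \sum_c psi k (u c) * v (inl c) w + F^-1 * v (inr k) w.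
  have := vE (ffun_at k w); rewrite (bigD1 k)//= big1 ?addr0 => [|j /negbTE jk].
    rewrite ffunE eqxx => ->; rewrite big_sumType.
    congr (_ + _) => /=; last first.
      rewrite (bigD1 k)//= big1 ?addr0 ?ffunE ?eqxx ?dualZ// => j /negbTE jk.
      by rewrite ffunE jk scaler0 linear0.
    apply: eq_bigr => c _; rewrite -dualZ; congr (v _ _).
    rewrite (bigD1 k)//= big1 ?addr0 ?ffunE ?eqxx// => j /negbTE jk.
    by rewrite ffunE jk scaler0.
  by rewrite ffunE jk linear0.
have WE k : W k = \sum_c psi k (u c) *: v (inl c) + F^-1 *: v (inr k).
  by apply: bopP => w; rewrite Ww bopD bopZ bop_sum.
have -> : \sum_k f k (W k) =
    \sum_c (\sum_k psi k (u c) * f k (v (inl c))) + \sum_k F^-1 * f k (v (inr k)).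
  rewrite exchange_big/= -big_split/=; apply: eq_bigr => k _.
  rewrite WE linearD linear_sum/= dualZ; congr (_ + _).
  by apply: eq_bigr => c _; rewrite dualZ.
have Mt : M * t <= M + e.
  rewrite /t mulrDr mulr1 lerD2l /d.
  have -> : M * (n%:R * (e / (F * (n%:R + 1) * (M + 1)) * F)) =
     e * ((n%:R / (n%:R + 1)) * (M / (M + 1))).
    by field; rewrite !gt_eqF// ltr_wpDl.
  rewrite ler_piMr ?(ltW e0)// mulr_ile1 ?divr_ge0 ?addr_ge0//.
    by rewrite ler_pdivrMr ?ltr_wpDl// mul1r lerDl.
  by rewrite ler_pdivrMr ?ltr_wpDl// mul1r lerDl.
(* The net terms are at most [|v c|] by contractivity of the form, the remaining ones by
   [|f k| <= F]. *)
rewrite (le_trans _ Mt)// (le_trans _ vM)// big_sumType/= lerD//.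
  apply: ler_sum => c _; rewrite (le_trans (ler_norm _))//.
  by rewrite (le_trans (f1 _ _))// ler_piMr// u1.
apply: ler_sum => k _; rewrite ler_pdivrMl// (le_trans (ler_norm _))//.
by rewrite (le_trans (ler_norm_bop _ _))// ler_wpM2r.
Qed.

End FiniteRank.

(** * Reduction of bounded forms to finite-rank ones *)

Section MetricApproximation.
Context {R : realType}.

Lemma finite_rank_coordinates (V W : normedModType R) (S : bop V W) :
  finite_dim_subspace (range S) ->
  exists n (psi : 'I_n -> dual R V) (e : 'I_n -> W),
    forall x, S x = \sum_k psi k x *: e k.
Proof.
move=> [n [e Se]]; have [phi phiE] := span_coordinates e.
have psiP k : {psi : dual R V | forall x, psi x = phi k (S x)}.
  apply: cid; have [a x y|x|psi psiE _] :=
    @dual_of_linear R V (phi k \o S) (`|phi k| * `|S|) (mulr_ge0 (normr_ge0 _) (normr_ge0 _)).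
  - by rewrite /= !linearP.
  - rewrite /= (le_trans (ler_norm_bop _ _))// -mulrA ler_wpM2l//.
    exact: ler_norm_bop.
  by exists psi.
exists n, (fun k => sval (psiP k)), e => x.
have : range S (S x) by exists x.
rewrite Se => -[c cE]; rewrite {1}cE phiE -cE.
by apply: eq_bigr => k _; case: (psiP k) => psi /= ->.
Qed.

Lemma MAP_finite (W : normedModType R) (s : seq W) (e : R) :
  metric_approximation_property W -> 0 < e ->
  exists S : bop W W, [/\ finite_dim_subspace (range S), `|S| <= 1 &
    forall w, w \in s -> `|w - S w| <= e].
Proof.
move=> [I [le [S [[[i0 _] lexx' letr dir] fS S1 Scvg]]]] e0.
(* The estimate is kept for all later indices, so that directedness can combine it with that of a
   further vector. *)
suff [i iP] : exists i, forall j, le i j -> forall w, w \in s -> `|w - S j w| <= e.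
  by exists (S i); split => //; exact: iP.
elim: s => [|w s [i iP]]; first by exists i0.
have /Scvg/= [k _ kP] : nbhs w (ball w e) by exact: nbhsx_ballx.
have [j ij kj] := dir i k; exists j => l jl x.
rewrite inE => /predU1P[->|]; last by apply: iP; exact: letr jl.
have := kP l (letr _ _ _ kj jl); rewrite -ball_normE/=; exact: ltW.
Qed.

Variables (X Y : normedModType R).

(** Summing over [s] first turns the left side into [\sum_k f k (W k)] with [W k] in X'', and the
    previous bound applies with V = X'. Tuples [g] there are contractive finite-rank operators from
    Y to X'. *)
Lemma finite_rank_form_bound n (psi : 'I_n -> dual R Y)
    (f : 'I_n -> dual R (bidual R X)) (s : seq (bidual R X * Y)) (M : R) :
  (forall xi y, `|\sum_k psi k y * f k xi| <= `|xi| * `|y|) ->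
  (forall T : bop Y (dual R X), `|T| <= 1 -> \sum_(p <- s) p.1 (T p.2) <= M) ->
  \sum_(p <- s) \sum_k psi k p.2 * f k p.1 <= M.
Proof.
move=> f1 TM; rewrite exchange_big/=.
have -> : \sum_k \sum_(p <- s) psi k p.2 * f k p.1 =
    \sum_k f k (\sum_(p <- s) psi k p.2 *: p.1).
  apply: eq_bigr => k _; rewrite linear_sum/=.
  by apply: eq_bigr => p _; rewrite dualZ.
apply: dual_finite_rank_bound f1 _ => g g1.
have [a x y|x|T TE T1] := @bop_of_linear R Y (dual R X)
    (fun y => \sum_k psi k y *: g k) 1 ler01.
- rewrite scaler_sumr -big_split/=; apply: eq_bigr => k _.
  by rewrite linearP scalerDl scalerA.
- by rewrite mul1r.
rewrite (le_trans _ (TM _ T1))//.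
under eq_bigr do rewrite bop_sum.
rewrite exchange_big/=; apply: ler_sum => p _.
by rewrite TE linear_sum; apply: ler_sum => k _; rewrite /= dualZ.
Qed.

(** Composing [B] with a contractive finite-rank operator, in whichever variable has the
    approximation property, leaves it contractive, makes it finite-rank and changes its values on
    [s] arbitrarily little. *)
Lemma MAP_form_bound (B : bop Y (dual R (bidual R X)))
    (s : seq (bidual R X * Y)) (M : R) :
  metric_approximation_property (bidual R X) \/ metric_approximation_property Y ->
  `|B| <= 1 ->
  (forall T : bop Y (dual R X), `|T| <= 1 -> \sum_(p <- s) p.1 (T p.2) <= M) ->
  \sum_(p <- s) B p.2 p.1 <= M.
Proof.
move=> MAP B1 TM; apply/ler_addgt0Pr => e e0.
have Bxy xi y : `|B y xi| <= `|xi| * `|y|.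
  rewrite (le_trans (ler_norm_bop _ _))// mulrC ler_wpM2l//.
  by rewrite (le_trans (ler_norm_bop _ _))// ler_piMl.
pose C : R := \sum_(p <- s) (`|p.1| + `|p.2|) + 1.
have C0 : 0 < C by rewrite ltr_wpDl// sumr_ge0// => p _; rewrite addr_ge0.
have eC : 0 < e / C by rewrite divr_gt0.
have sum_le (F : bidual R X * Y -> R) :
    (forall p, p \in s -> B p.2 p.1 - F p <= e / C * (`|p.1| + `|p.2|)) ->
    \sum_(p <- s) F p <= M -> \sum_(p <- s) B p.2 p.1 <= M + e.
  move=> FB FM; rewrite -lerBlDl (le_trans (lerB (lexx _) FM))// -sumrB.
  rewrite (@le_trans _ _ (\sum_(p <- s) e / C * (`|p.1| + `|p.2|)))//.
    by rewrite big_seq [leRHS]big_seq; exact: ler_sum.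
  by rewrite -mulr_sumr mulrAC ler_pdivrMr// ler_wpM2l ?(ltW e0)// lerDl.
case: MAP => /MAP_finite h.
- have [S [fS S1 SP]] := h (map fst s) _ eC.
  have [n [phi [a SE]]] := finite_rank_coordinates fS.
  have psiP k : {psi : dual R Y | forall y, psi y = B y (a k)}.
    apply: cid; have [b x y|x|psi psiE _] :=
      @dual_of_linear R Y (fun y => B y (a k)) `|a k| (normr_ge0 _).
    + by rewrite linearP.
    + exact: Bxy.
    by exists psi.
  (* Here X'' is approximated: the functionals on X'' are the coordinates of [S]. *)
  have BS y xi : \sum_k sval (psiP k) y * phi k xi = B y (S xi).
    rewrite SE linear_sum; apply: eq_bigr => k _.
    by rewrite /= dualZ mulrC; case: (psiP k) => ? /= ->.
  apply: sum_le (finite_rank_form_bound (psi := fun k => sval (psiP k)) (f := phi) _ TM).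
    move=> p ps; rewrite BS -raddfB (le_trans (ler_norm _))// (le_trans (Bxy _ _))//.
    by rewrite ler_pM ?lerDr// SP// map_f.
  move=> xi y; rewrite BS (le_trans (Bxy _ _))// ler_wpM2r//.
  by rewrite (le_trans (ler_norm_bop _ _))// ler_piMl.
have [S [fS S1 SP]] := h (map snd s) _ eC.
have [n [psi [a SE]]] := finite_rank_coordinates fS.
(* Here Y is approximated: the functionals on X'' are the values [B (a k)]. *)
have BS y xi : \sum_k psi k y * B (a k) xi = B (S y) xi.
  by rewrite SE linear_sum bop_sum; apply: eq_bigr => k _; rewrite linearZ.
apply: sum_le (finite_rank_form_bound (psi := psi) (f := fun k => B (a k)) _ TM).
  move=> p ps; rewrite BS -bopB -raddfB (le_trans (ler_norm _))//.
  rewrite (le_trans (Bxy _ _))// mulrC.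
  by rewrite ler_pM ?lerDl// SP// map_f.
move=> xi y; rewrite BS (le_trans (Bxy _ _))// ler_wpM2l//.
by rewrite (le_trans (ler_norm_bop _ _))// ler_piMl.
Qed.

End MetricApproximation.

(** * Duality for the projective norm *)

Section TensorFunctionals.
Context {R : realType} {X Y : normedModType R}.

Fact is_tensor_elementary (x : X) (y : Y) :
  tensor_sum [:: (x, y)] \in @is_tensor R X Y.
Proof. by apply/asboolP; exists [:: (x, y)]. Qed.

Definition elementary_tensor x y : tensor X Y := Tensor (is_tensor_elementary x y).

Lemma elementary_tensor_linearl y a x x' :
  elementary_tensor (a *: x + x') y =
  a *: elementary_tensor x y + elementary_tensor x' y.
Proof.
apply: val_inj; apply/funext => B.
rewrite [RHS](_ : _ = a *: tensor_sum [:: (x, y)] B + tensor_sum [:: (x', y)] B)//.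
by rewrite /= /tensor_sum !big_seq1 linearPl.
Qed.

Lemma elementary_tensor_linearr x a y y' :
  elementary_tensor x (a *: y + y') =
  a *: elementary_tensor x y + elementary_tensor x y'.
Proof.
apply: val_inj; apply/funext => B.
rewrite [RHS](_ : _ = a *: tensor_sum [:: (x, y)] B + tensor_sum [:: (x, y')] B)//.
by rewrite /= /tensor_sum !big_seq1 linearPr.
Qed.

Lemma elementary_tensor_norm_le x y : `|elementary_tensor x y| <= `|x| * `|y|.
Proof.
have := @proj_norm_le R X Y (elementary_tensor x y) [:: (x, y)] erefl.
by rewrite /rep_cost big_seq1.
Qed.

Lemma tensor_elementaryE (t : tensor X Y) s : tensor_val t = tensor_sum s ->
  t = \sum_(p <- s) elementary_tensor p.1 p.2.
Proof.
move=> ts; apply: val_inj; rewrite /= ts; elim: s {ts} => [|p s IH].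
  by rewrite big_nil; apply/funext => B; rewrite /tensor_sum big_nil.
rewrite big_cons; apply/funext => B.
rewrite [RHS](_ : _ = tensor_sum [:: (p.1, p.2)] B +
  tensor_val (\sum_(p <- s) elementary_tensor p.1 p.2) B)// -IH.
by rewrite /tensor_sum big_cons big_seq1.
Qed.

(** A tensor is a function of bilinear forms, so [tau] is evaluation at the form of [T]. It is at
    most [|T|] times the cost of every representation, hence [|T|] times the projective norm. *)
Lemma tensor_dual (T : bop Y (dual R X)) : exists2 tau : dual R (tensor X Y),
  (forall x y, tau (elementary_tensor x y) = T y x) & `|tau| <= `|T|.
Proof.
pose C (x : X) (y : Y) : R^o := T y x.
have bC : bilinear_for *:%R *:%R C.
  by split => [y a x x'|x a y y']; rewrite /C linearP.
pose D : {bilinear X -> Y -> R^o} :=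
  HB.pack C (bilinear_isBilinear.Build _ _ _ _ _ _ C bC).
have [//|t|tau tauE tauT] := @dual_of_linear R (tensor X Y)
  (fun t => tensor_val t D) `|T| (normr_ge0 _).
  apply/ler_addgt0Pr => e e0.
  have c0 : 0 < `|T| + 1 by rewrite ltr_wpDl.
  have [s ts se] := proj_norm_adherent t (divr_gt0 e0 c0).
  rewrite ts (le_trans (ler_norm_sum _ _ _))//.
  rewrite (@le_trans _ _ (`|T| * rep_cost s))//.
    rewrite /rep_cost mulr_sumr; apply: ler_sum => p _.
    rewrite /= (le_trans (ler_norm_bop _ _))// mulrA mulrAC ler_wpM2r//.
    exact: ler_norm_bop.
  rewrite (le_trans (ler_wpM2l _ (ltW se)))// mulrDr lerD2l mulrCA.
  by rewrite ler_piMr ?(ltW e0)// ler_pdivrMr// mul1r lerDl.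
by exists tau => // x y; rewrite tauE /= /tensor_sum big_seq1.
Qed.

(** The lower bound comes from the product of functionals norming [x] and [y]. *)
Lemma elementary_tensor_norm x y : `|elementary_tensor x y| = `|x| * `|y|.
Proof.
apply/eqP; rewrite eq_le elementary_tensor_norm_le/=.
have [phi phix phi1] := exists_norming x.
have [psi psiy psi1] := exists_norming y.
have [a z z' w|a z w w'|z w|T TE T1] := @bop_of_bilinear R Y X
    (fun y x => psi y * phi x) 1 ler01.
- by rewrite linearP mulrDl -mulrA.
- by rewrite linearP mulrDr; congr (_ + _); exact: mulrCA.
- by rewrite normrM mul1r ler_pM.
have [tau tauE tau1] := tensor_dual T.
have := ler_norm_bop tau (elementary_tensor x y).
rewrite tauE TE phix psiy mulrC ger0_norm ?mulr_ge0// => /le_trans; apply.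
by rewrite ler_piMl// (le_trans tau1).
Qed.

End TensorFunctionals.

(** * The projection of the bidual onto the space *)

Section LEmbedded.
Context {R : realType} {X : normedModType R}.

(** [P] is the projection along Z, and [z] a normalised element of Z, which is non-zero because
    [canon] is not onto. *)
Lemma L_projection : L_embedded X -> ~ reflexive_space X ->
  exists (P : bidual R X -> X) (z : bidual R X),
  [/\ linear P, forall x : X, P (canon x) = x,
    forall xi, `|P xi| + `|xi - canon (P xi)| = `|xi|, `|z| = 1 & P z = 0].
Proof.
move=> [Z [[Z0 ZD] Zdec Znorm]] nrefl.
have decP xi : {x : X | xi - canon x \in Z}.
  apply: cid; have [x [z [zZ ->]]] := Zdec xi; exists x.
  by rewrite addrAC subrr add0r.
pose P xi := sval (decP xi).
have PZ xi : xi - canon (P xi) \in Z by rewrite /P; case: (decP xi).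
(* Two decompositions differ by an element of Z that is also in the image of [canon]; norm
   additivity applied to it and its opposite makes it 0. *)
have Puniq xi x : xi - canon x \in Z -> P xi = x.
  move=> xZ; have := ZD (-1) _ _ xZ (PZ xi).
  have -> : -1 *: (xi - canon x) + (xi - canon (P xi)) = - canon (P xi - x).
    by rewrite scaleN1r opprB addrA subrK raddfB/= opprB.
  move/(Znorm (P xi - x)); rewrite subrr normr0 normrN canon_norm => /esym/eqP.
  by rewrite paddr_eq0// andbb normr_eq0 subr_eq0 => /eqP.
have Pnorm xi : `|P xi| + `|xi - canon (P xi)| = `|xi|.
  by rewrite -canon_norm -Znorm// addrC subrK.
have lP : linear P.
  move=> a xi eta; apply: Puniq; rewrite linearP/= opprD addrACA -scalerBr.
  exact: ZD.
have Pcanon (x : X) : P (canon x) = x by apply: Puniq; rewrite subrr.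
have [z zZ z0] : exists2 z, z \in Z & z != 0.
  apply: contrapT => nz; apply: nrefl; apply/seteqP; split => // xi _.
  exists (P xi) => //; apply/eqP; rewrite -subr_eq0 -opprB oppr_eq0.
  by apply: contrapT => /negP h; apply: nz; exists (xi - canon (P xi)).
exists P, (`|z|^-1 *: z); split => //; first exact: normfZV.
apply: Puniq; rewrite linear0 subr0.
by have := ZD `|z|^-1 _ _ zZ Z0; rewrite addr0.
Qed.

End LEmbedded.

(** * Construction of the octahedral direction *)

(** Contractive operators see each of [u] and [z (x) y0] with value at most 1, up to the
    approximation of [u]. If their sum gets a value near 2, both values are near 1. *)
Lemma norming_operator (R : realType) (X Y : normedModType R)
    (P : bidual R X -> X) (z : bidual R X) (y0 : Y) (u : completion (tensor X Y))
    (e : R) :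
  metric_approximation_property (bidual R X) \/ metric_approximation_property Y ->
  linear P -> (forall x : X, P (canon x) = x) ->
  (forall xi, `|P xi| + `|xi - canon (P xi)| = `|xi|) ->
  `|z| = 1 -> P z = 0 -> `|y0| = 1 -> `|u| = 1 -> 0 < e ->
  exists (T : bop Y (dual R X)) (tau : dual R (tensor X Y)),
    [/\ forall x y, tau (elementary_tensor x y) = T y x, `|tau| <= 1,
      1 - e <= completion_val u tau & 1 - e <= z (T y0)].
Proof.
move=> MAP lP Pcanon Pnorm z1 Pz y01 u1 e0.
have d0 : 0 < e / 4 by rewrite divr_gt0.
have [tau0 tau01 utau] := dual_norm_adherent (completion_val u) d0.
(* [u] is replaced by an algebraic tensor [t], which has a finite representation. *)
have /in_completionP/(_ _ d0)[t ut] := completion_valP u.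
have t1 : `|t| <= 1 + e / 4.
  rewrite -(canon_norm t) -(subKr (completion_val u) (canon t)).
  by rewrite (le_trans (ler_normB _ _))// lerD ?(ltW ut)// [leLHS]u1.
have utE (tau : dual R (tensor X Y)) : `|tau| <= 1 ->
    `|completion_val u tau - tau t| <= e / 4.
  move=> tau1; rewrite (le_trans (ler_norm_bop (completion_val u - canon t) tau))//.
  by rewrite (le_trans _ (ltW ut))// ler_piMr.
have [s ts _] := proj_norm_adherent t ltr01.
have tE := tensor_elementaryE ts.
have [psi0 psi0y psi01] := exists_norming y0.
have [h hz h1] := exists_norming z.
have [a y y' xi|a y xi eta|y xi|B BE B1] := @bop_of_bilinear R Y (bidual R X)
    (fun y xi => tau0 (elementary_tensor (P xi) y) + psi0 y * h (xi - canon (P xi)))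
    1 ler01.
- by rewrite elementary_tensor_linearr !linearP mulrDl -mulrA mulrDr addrACA.
- rewrite lP elementary_tensor_linearl linearP.
  rewrite (_ : a *: xi + eta - _ = a *: (xi - canon (P xi)) + (eta - canon (P eta))).
    by rewrite linearP mulrDr addrACA mulrDr; congr (_ + _ + _); exact: mulrCA.
  by rewrite linearP/= opprD addrACA scalerBr.
- rewrite mul1r -Pnorm mulrDr (le_trans (ler_normD _ _))// lerD//.
    rewrite (le_trans (ler_norm_bop _ _))// elementary_tensor_norm mulrC (mulrC `|y|).
    by rewrite ler_piMr// mulr_ge0.
  by rewrite normrM ler_pM.
(* [B] gives 1 at [(z, y0)] and [tau0 t] on the rest; one [e / 4] is lost in norming [u], the other
   in replacing [u] by [t]. If no [T] did as well, [MAP_form_bound] would be contradicted. *)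
have [T T1 TM] : exists2 T : bop Y (dual R X), `|T| <= 1 &
    2 - e / 4 - e / 4 < \sum_(p <- (z, y0) :: [seq (canon p.1, p.2) | p <- s]) p.1 (T p.2).
  apply: contrapT => nT.
  have := MAP_form_bound (s := (z, y0) :: [seq (canon p.1, p.2) | p <- s])
    (M := 2 - e / 4 - e / 4) MAP B1.
  have := utE _ tau01; move: utau; rewrite [`|completion_val u|]u1 => utau.
  rewrite ler_norml => /andP[_ utt].
  rewrite big_cons big_map/= BE Pz linear0 subr0 hz psi0y z1 y01.
  have -> : elementary_tensor (0 : X) y0 = 0.
    by apply/eqP; rewrite -normr_le0 elementary_tensor_norm normr0 mul0r.
  have -> : \sum_(p <- s) B p.2 (canon p.1) = tau0 t.
    rewrite tE linear_sum; apply: eq_bigr => p _.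
    by rewrite BE Pcanon subrr linear0 mulr0 addr0.
  rewrite linear0 add0r mulr1 => h'; have : 1 + tau0 t <= 2 - e / 4 - e / 4.
    apply: h' => T T1; rewrite leNgt; apply/negP => TM; apply: nT.
    by exists T.
  lra.
have [tau tauE tauT] := tensor_dual T.
have tau1 : `|tau| <= 1 by exact: le_trans T1.
exists T, tau; split => //.
- have := utE _ tau1; move: TM; rewrite big_cons big_map/=.
  have -> : \sum_(p <- s) T p.2 p.1 = tau t.
    by rewrite tE linear_sum; apply: eq_bigr => p _; rewrite /= tauE.
  have : z (T y0) <= 1.
    rewrite (le_trans (ler_norm _))// (le_trans (ler_norm_bop _ _))// z1 mul1r.
    by rewrite (le_trans (ler_norm_bop _ _))// y01 mulr1.
  rewrite ler_norml => zT TM /andP[ut' _]; lra.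
move: TM; rewrite big_cons big_map/=.
have -> : \sum_(p <- s) T p.2 p.1 = tau t.
  by rewrite tE linear_sum; apply: eq_bigr => p _; rewrite /= tauE.
have : tau t <= 1 + e / 4.
  rewrite (le_trans (ler_norm _))// (le_trans (ler_norm_bop _ _))//.
  by rewrite (le_trans _ t1)// ler_piMl.
lra.
Qed.

Theorem theorem4p3 (R : realType) (X Y : completeNormedModType R)
  (X_nonzero : exists x : X, x != 0) (Y_nonzero : exists y : Y, y != 0)
  (X_nonreflexive : ~ reflexive_space X) (X_L_embedded : L_embedded X)
  (MAP : metric_approximation_property (bidual R X) \/
         metric_approximation_property Y) :
  octahedral (proj_tensor X Y).
Proof.
move=> E e [n [a EE]] e0.
have [P [z [lP Pcanon Pnorm z1 Pz]]] := L_projection X_L_embedded X_nonreflexive.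
have [w w0] := X_nonzero; have [y yN0] := Y_nonzero.
pose y0 := `|y|^-1 *: y; have y01 : `|y0| = 1 by exact: normfZV.
(* The final loss is [3 * d]; the cap at 1 keeps [1 - 3 * d] positive for large [e]. *)
pose d := Num.min e 1 / 8.
have d0 : 0 < d by rewrite divr_gt0// lt_min e0 ltr01.
have de : 8 * d <= e.
  have : Num.min e 1 <= e by rewrite ge_min lexx.
  by rewrite /d; lra.
have d1 : 8 * d <= 1.
  have : Num.min e 1 <= 1 by rewrite ge_min lexx orbT.
  by rewrite /d; lra.
have e2d : 1 - e <= 1 - 2 * d by lra.
have e3d : 1 - e <= 1 - 3 * d by lra.
have [phi phiE] := span_coordinates a.
pose A : R := \sum_i `|a i| + 1.
have A0 : 0 < A by rewrite ltr_wpDl// sumr_ge0.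
(* Coordinates within [d / A] give vectors within [d], as [A] exceeds the sum of the [|a i|]. *)
have [i v [_ v1]||K [u [uE uP]]] := @finite_net R (proj_tensor X Y) n
    (fun i v => phi i v) [set v | E v /\ `|v| = 1] (\sum_i `|phi i|) (d / A).
- rewrite (le_trans (ler_norm_bop _ _))// v1 mulr1.
  by rewrite (bigD1 i)//= lerDl sumr_ge0.
- by rewrite divr_gt0.
have TP k : {T : bop Y (dual R X) * dual R (tensor X Y) |
    [/\ forall x y, T.2 (elementary_tensor x y) = T.1 y x, `|T.2| <= 1,
      1 - d <= completion_val (u k) T.2 & 1 - d <= z (T.1 y0)]}.
  apply: cid; have [_ u1] := uE k.
  by have [T [tau h]] := norming_operator MAP lP Pcanon Pnorm z1 Pz y01 u1 d0; exists (T, tau).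
pose T k := (sval (TP k)).1; pose tau k := (sval (TP k)).2.
have tauE k x y' : tau k (elementary_tensor x y') = T k y' x.
  by rewrite /tau /T; case: (TP k) => ? [].
have tau1 k : `|tau k| <= 1 by rewrite /tau; case: (TP k) => ? [].
have tauu k : 1 - d <= completion_val (u k) (tau k).
  by rewrite /tau; case: (TP k) => ? [].
have zT k : 1 - d <= z (T k y0) by rewrite /T; case: (TP k) => ? [].
have z_le1 : `|z| <= 1 by rewrite z1.
have [x x1 xP] := helly (fun k => T k y0) z_le1 d0.
have Tx k : 1 - 2 * d <= T k y0 x.
  by have := xP k; have := zT k; rewrite ler_norml => ? /andP[? ?]; lra.
have [x' x'1 Tx'] : exists2 x' : X, `|x'| = 1 & forall k, 1 - 3 * d <= T k y0 x'.
  (* If [x = 0], then [Tx] shows that the net is empty and any unit vector will do. Otherwise [x] is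
     normalised, using [(1 - 3 * d) * (1 + d) <= 1 - 2 * d]. *)
  have [x0|xN0] := eqVneq x 0.
    exists (`|w|^-1 *: w) => [|k]; first exact: normfZV.
    by have := Tx k; rewrite x0 linear0 => ?; lra.
  exists (`|x|^-1 *: x) => [|k]; first exact: normfZV.
  rewrite dualZ ler_pdivlMl ?normr_gt0// mulrC.
  rewrite (le_trans _ (Tx k))// (@le_trans _ _ ((1 - 3 * d) * (1 + d)))//.
    by rewrite ler_wpM2l//; lra.
  by nra.
pose b : proj_tensor X Y := to_completion (elementary_tensor x' y0).
have b1 : `|b| = 1.
  by rewrite to_completion_norm elementary_tensor_norm x'1 y01 mulr1.
exists b => //.
have EZ (c : R) v : E v -> E (c *: v).
  rewrite EE => -[f ->]; exists (fun i => c * f i).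
  by rewrite scaler_sumr; apply: eq_bigr => i _; rewrite scalerA.
have pos v l : E v -> 0 <= l -> (1 - e) * (`|v| + l) <= `|v + l *: b|.
  move=> Ev l0; have [v0|vN0] := eqVneq v 0.
    rewrite v0 normr0 !add0r normrZ b1 mulr1 ger0_norm//.
    by rewrite ler_piMl// gerBl ltW.
  have v0 : 0 < `|v| by rewrite normr_gt0.
  pose v' := `|v|^-1 *: v.
  have v'1 : `|v'| = 1 by exact: normfZV.
  have Ev' : E v' by exact: EZ.
  have [k kP] := uP v' (conj Ev' v'1).
  have span v2 : E v2 -> v2 = \sum_i phi i v2 *: a i.
    by rewrite EE => -[c cE]; rewrite {1}cE phiE -cE.
  have v'u : `|v' - u k| <= d.
    rewrite (span _ Ev') (span _ (uE k).1) -sumrB (le_trans (ler_norm_sum _ _ _))//.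
    rewrite (@le_trans _ _ (\sum_i d / A * `|a i|))//.
      by apply: ler_sum => i _; rewrite -scalerBl normrZ ler_wpM2r.
    rewrite -mulr_sumr mulrAC ler_pdivrMr// ler_wpM2l ?(ltW d0)//.
    by rewrite lerDl.
  have ev_le (v2 : proj_tensor X Y) : completion_val v2 (tau k) <= `|v2|.
    rewrite (le_trans (ler_norm _))// (le_trans (ler_norm_bop _ _))//.
    by rewrite ler_piMr.
  (* One [d] is lost in norming the net point [u k], another in passing from it to [v']. *)
  have evv' : 1 - 2 * d <= completion_val v' (tau k).
    have h : completion_val (u k) (tau k) - completion_val v' (tau k) <= d.
      by apply: le_trans (ev_le (u k - v')) _; rewrite distrC.
    rewrite (_ : 1 - 2 * d = 1 - d - d); last by ring.
    by rewrite lerBlDr (le_trans (tauu k))// -lerBlDl.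
  rewrite (le_trans _ (ev_le _))//.
  (* The same functional [tau k] is large on both [v'] and [b], so the two norms nearly add up. *)
  have -> : completion_val (v + l *: b) (tau k) =
      `|v| * completion_val v' (tau k) + l * T k y0 x'.
    rewrite -tauE -{1}[v]scale1r -(divff (lt0r_neq0 v0)) -scalerA.
    by [].
  rewrite mulrDr lerD// mulrC ler_wpM2l//.
    exact: le_trans e2d evv'.
  exact: le_trans e3d (Tx' k).
(* A negative [l] reduces to the case of [- v] and [- l], as E is symmetric. *)
move=> v l Ev; have [l0|l0] := leP 0 l; first by rewrite ger0_norm// pos.
rewrite ltr0_norm// -[`|v|]normrN -[leRHS]normrN opprD -scaleNr.
rewrite pos// ?oppr_ge0 ?ltW//; rewrite -scaleN1r; exact: EZ.
Qed.
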